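(* Let $G$ be a periodic compactly ruled locally compact group and let $\nu(G)=\{p\in\pi: [G_p,G_{p'}]=\{1\}\}$. Then the set $G_{\nu(G)'}$ of $\nu(G)'$-elements (where $\nu(G)'=\pi\setminus\nu(G)$) is a closed normal subgroup of $G$, for each $p\in\nu(G)$ the set $G_p$ is a normal $p$-Sylow subgroup, and there is a family of compact open subgroups $U_p\subseteq G_p$, $p\in\nu(G)$, such that $$G\cong G_{\nu(G)'}\times\prod_{p\in\nu(G)}^{\mathrm{loc}}(G_p,U_p).$$
   Context: $\pi$ is the set of all primes, $p'=\pi\setminus\{p\}$. A topological group $G$ is periodic if it is locally compact, totally disconnected, and $\overline{\langle g\rangle}$ is compact for every $g$; it is compactly ruled if it is the directed union of its compact open subgroups. For $g\in G$, $\overline{\langle g\rangle}\cong\prod_p M_p$ with $M_p$ its $p$-primary component; for a set $\sigma$ of primes, $g$ is a $\sigma$-element if $M_q=\{1\}$ for $q\notin\sigma$; $G_\sigma$ is the set of $\sigma$-elements and $G_p=G_{\{p\}}$; a $\sigma$-Sylow subgroup is a maximal subgroup consisting of $\sigma$-elements. Local product: for locally compact groups $G_j$ ($j\in J$) with compact open subgroups $C_j$, $\prod^{\mathrm{loc}}_{j\in J}(G_j,C_j)$ is the subgroup of $\prod_j G_j$ of tuples $(g_j)$ with $g_j\notin C_j$ for only finitely many $j$, endowed with the unique group topology in which $\prod_j C_j$ (with the Tychonoff topology) is an open subgroup. *)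

(* Defs.v *)
From HB Require Import structures.
From mathcomp Require Import all_boot all_order all_algebra.
From mathcomp Require Import all_classical all_reals all_analysis.
Set Implicit Arguments. Unset Strict Implicit. Unset Printing Implicit Defensive.
Import Order.TTheory GRing.Theory Num.Theory.
Local Open Scope classical_set_scope.

Record tgroup (T : topologicalType) := TGroup {
  tmul : T -> T -> T; tinv : T -> T; tone : T }.

Section TopGroups.
Variables (T : topologicalType) (G : tgroup T).
Local Notation mul := (tmul G).
Local Notation inv := (tinv G).
Local Notation one := (tone G).

Definition is_topgroup : Prop :=
  [/\ (forall x y z, mul x (mul y z) = mul (mul x y) z),
      (forall x, mul one x = x /\ mul x one = x),
      (forall x, mul (inv x) x = one /\ mul x (inv x) = one) &
      continuous (fun xy : T * T => mul xy.1 (inv xy.2))].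

Definition gpow (x : T) (n : nat) : T := iter n (mul x) one.
Definition gpowz (x : T) (z : int) : T :=
  match z with Posz n => gpow x n | Negz n => inv (gpow x n.+1) end.

Definition cyclic_sub (g : T) : set T := [set y | exists z : int, y = gpowz g z].
Definition mono_closure (g : T) : set T := closure (cyclic_sub g).

Definition is_subgroup (H : set T) : Prop :=
  [/\ H one, (forall x y, H x -> H y -> H (mul x y)) & (forall x, H x -> H (inv x))].

Definition is_normal_subgroup (H : set T) : Prop :=
  is_subgroup H /\ forall g h, H h -> H (mul (mul g h) (inv g)).

Definition locally_compact_space : Prop :=
  forall x : T, exists K : set T, compact K /\ nbhs x K.

Definition periodic_group : Prop :=
  [/\ locally_compact_space, totally_disconnected [set: T] &
      forall g, compact (mono_closure g)].

Definition compactly_ruled : Prop :=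
  exists F : set (set T),
    [/\ (forall U, F U -> [/\ is_subgroup U, compact U & open U]),
        (forall U V, F U -> F V -> exists W, [/\ F W, U `<=` W & V `<=` W]) &
        \bigcup_(U in F) U = [set: T]].

(* p-primary component M_p of the procyclic group closure <g>:
   its topologically p-torsion elements (y^(p^n) --> 1). *)
Definition primary_comp (g : T) (p : nat) : set T :=
  [set y | mono_closure g y /\ (fun n : nat => gpow y (p ^ n)) @ \oo --> one].

Definition sigma_elt (sigma : set nat) (g : T) : Prop :=
  forall q, prime q -> ~ sigma q -> primary_comp g q = [set one].

Definition G_sigma (sigma : set nat) : set T := [set g | sigma_elt sigma g].
Definition G_p (p : nat) : set T := G_sigma [set p].
Definition pcompl (p : nat) : set nat := [set q | prime q /\ q <> p].

Definition is_sylow (sigma : set nat) (S : set T) : Prop :=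
  [/\ is_subgroup S, S `<=` G_sigma sigma &
      forall H, is_subgroup H -> H `<=` G_sigma sigma -> S `<=` H -> H = S].

Definition comm (x y : T) : T := mul (mul (inv x) (inv y)) (mul x y).

Definition nu : set nat :=
  [set p | prime p /\ forall x y, G_p p x -> G_sigma (pcompl p) y -> comm x y = one].
Definition nu' : set nat := [set p | prime p /\ ~ nu p].

Definition open_in (A B : set T) : Prop := exists O : set T, open O /\ B = O `&` A.

Definition locprod_carrier (U : nat -> set T) : set (T * (nat -> T)) :=
  [set z | [/\ G_sigma nu' z.1,
               (forall p, nu p -> G_p p (z.2 p)),
               (forall p, ~ nu p -> z.2 p = one) &
               finite_set [set p | nu p /\ ~ U p (z.2 p)]]].

Definition locprod_mul (z w : T * (nat -> T)) : T * (nat -> T) :=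
  (mul z.1 w.1, fun p => mul (z.2 p) (w.2 p)).

(* Open sets: product of the subspace topology on G_{nu'} with the unique
   group topology on the local product in which prod_p U_p (Tychonoff) is
   open; a base of neighbourhoods of f is given by the left translates
   f * N of the basic Tychonoff neighbourhoods N of 1 in prod_p U_p. *)
Definition locprod_open (U : nat -> set T) (W : set (T * (nat -> T))) : Prop :=
  W `<=` locprod_carrier U /\
  forall z, W z -> exists (O : set T) (S : set nat) (V : nat -> set T),
    [/\ open O, O z.1, finite_set S,
        (forall p, S p -> open (V p) /\ V p (z.2 p)) &
        forall w, locprod_carrier U w -> O w.1 ->
          (forall p, S p -> V p (w.2 p)) ->
          (forall p, nu p -> U p (mul (inv (z.2 p)) (w.2 p))) -> W w].

Definition locprod_iso (U : nat -> set T) (phi : T -> T * (nat -> T)) : Prop :=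
  [/\ (forall x, locprod_carrier U (phi x)),
      (forall x y, phi x = phi y -> x = y),
      (forall z, locprod_carrier U z -> exists x, phi x = z) &
      (forall x y, phi (mul x y) = locprod_mul (phi x) (phi y))] /\
  ((forall W, locprod_open U W -> open (phi @^-1` W)) /\
   (forall O, open O -> locprod_open U (phi @` O))).

End TopGroups.

(* Main.v *)
(** A compact open subgroup [K] of [G] is profinite, so points of [K] are
    separated by the locally constant morphisms from [K] to finite groups (the
    permutation actions on cosets of open subgroups).  The [pi]-part of [x] is
    the point of the closure of [<x>] whose image under every such morphism [f]
    is the [pi]-part of [f x]; it is a cluster point of a sequence of powers of
    [x].  The [q]-primary component of [<x>] is trivial iff the [q]-part of [x]
    is, so everything reduces to finite groups.

    If in a finite group [H] the [p]-elements commute with the [p']-elements,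
    then the subgroup [A] generated by the [p']-elements has a central Sylow
    [p]-subgroup; Schur-Zassenhaus makes [A] a [p']-group and then gives it a
    complement containing all [p]-elements, so that taking [p]-parts and
    [p']-parts are endomorphisms of [H].  Hence for [p] in [nu] the [p]-part is
    an endomorphism of [G], as is the [nu']-part, and [x] is sent to the
    family of its [nu']-part and [p]-parts.  An element with prescribed parts
    in [K] is a cluster point of the partial products. *)
Require Import Defs.
From HB Require Import structures.
From mathcomp Require Import all_boot all_order all_algebra.
From mathcomp Require Import all_classical all_reals all_analysis.
From mathcomp Require Import all_fingroup all_solvable.
Set Implicit Arguments.
Unset Strict Implicit.
Unset Printing Implicit Defensive.
Local Open Scope classical_set_scope.

(** * Parts of elements of a finite group *)

Section FiniteGroups.
Import GroupScope.

Lemma normal_Hall_compl (gT : finGroupType) (G Q : {group gT}) pi :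
  pi.-Hall(G) Q -> normal Q G ->
  exists2 B : {group gT}, pi^'.-group B & Q * B = G.
Proof.
move=> hallQ nQG; have [_ _] := and3P hallQ.
have /splitsP[B /complP[tiQB defG]] :=
  SchurZassenhaus_split (pHall_Hall hallQ) nQG.
have sQG := normal_sub nQG.
move=> p'i; exists B => //; move: p'i.
by rewrite -divgS // -defG TI_cardMg // mulKn.
Qed.

(** Such an exponent fixes the pi-part of [x] and kills its pi'-part. Since only congruences on [k]
    matter, one exponent can serve many finite quotients at once. *)
Lemma expg_eq_constt (gT : finGroupType) (x : gT) (pi : nat_pred) k :
  k = 1 %[mod #[x]`_pi] -> (#[x]`_pi^')%N %| k -> x ^+ k = x.`_pi.
Proof.
move=> k1 k0; rewrite -{1}(consttC pi x) expgMn; last exact: commuteX2.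
have e (y : gT) m : k = m %[mod #[y]] -> y ^+ k = y ^+ m.
  by move=> km; apply/eqP; rewrite eq_expg_mod_order km.
rewrite (e _ 1%N) ?order_constt // expg1 (e _ 0%N) ?mulg1 // order_constt.
by rewrite mod0n; apply/eqP.
Qed.

Lemma constt_constt (gT : finGroupType) (x : gT) (pi rho : nat_pred) :
  x.`_pi.`_rho = x.`_[predI pi & rho].
Proof.
have c m n : commute (x ^+ m) (x ^+ n) by exact: commuteX2.
rewrite -{2}(consttC pi x) consttM; last exact: c.
rewrite -{2}(consttC rho x.`_pi) consttM; last first.
  by rewrite /constt -!expgM; exact: c.
have uP : [predI pi & rho].-elt x.`_pi.`_rho.
  rewrite /p_elt pnatI -!/(p_elt _ _) p_elt_constt andbT.
  by rewrite p_eltX ?p_elt_constt.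
(* Of the three factors of [x], only the iterated part is a (pi and rho)-element; the other two have
   trivial (pi and rho)-part. *)
rewrite (constt_p_elt uP) -[LHS]mulg1 -[in LHS](mulg1 1) mulgA.
have /constt1P-> : [predI pi & rho]^'.-elt x.`_pi.`_rho^'.
  apply: sub_p_elt (p_elt_constt _ _) => p; rewrite !inE.
  by case: (p \in pi).
have /constt1P-> // : [predI pi & rho]^'.-elt x.`_pi^'.
apply: sub_p_elt (p_elt_constt _ _) => p; rewrite !inE.
by case: (p \in pi).
Qed.

Lemma eq_in_constt (gT : finGroupType) (x : gT) (pi rho : nat_pred) :
  {in \pi(#[x]), pi =i rho} -> x.`_pi = x.`_rho.
Proof.
move=> e; rewrite /constt (eq_in_partn e).
rewrite (@eq_in_partn pi^'%N rho^'%N) // => p px.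
by rewrite !inE [in LHS]e.
Qed.

Section CommutingParts.
Variables (gT : finGroupType) (H : {group gT}) (p : nat).
Hypothesis cHp : forall x y, x \in H -> y \in H ->
  p.-elt x -> p^'.-elt y -> commute x y.

Let A := (<<[set x in H | p^'.-elt x]>>)%G.

Lemma gen_p'elt_normal : normal A H.
Proof.
rewrite /normal gen_subG; apply/andP; split.
  by apply/fintype.subsetP=> x; rewrite inE => /andP[].
apply/fintype.subsetP=> h hH.
rewrite inE -genJ gen_subG; apply/fintype.subsetP=> _ /imsetP[x + ->].
by rewrite inE => /andP[xH x_p']; rewrite mem_gen // inE groupJ //= p_eltJ.
Qed.

Lemma pelt_cent_gen_p'elt x : x \in H -> p.-elt x -> x \in 'C(A).
Proof.
move=> xH x_p; rewrite cent_gen; apply/centP=> y; rewrite inE => /andP[yH y_p'].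
exact: cHp.
Qed.

(** A Sylow p-subgroup [Q] of [A] centralizes the generators, so it is central and has a complement
    [B]. A generator [q * b] has p-part [q], which is trivial because it is a p'-element; so all
    generators lie in [B]. *)
Lemma gen_p'elt_pgroup : p^'.-group A.
Proof.
have [Q sylQ] := Sylow_exists p A.
have [sQA pQ _] := and3P sylQ.
have cQA : Q \subset 'C(A).
  apply/fintype.subsetP=> x xQ; apply: pelt_cent_gen_p'elt (mem_p_elt pQ xQ).
  apply: (fintype.subsetP (normal_sub gen_p'elt_normal)).
  exact: (fintype.subsetP sQA).
have nQA : normal Q A by rewrite /normal sQA cents_norm // centsC.
have [B p'B defA] := normal_Hall_compl sylQ nQA.
have sBA : B \subset A by rewrite -defA mulG_subr.
apply: (pgroupS _ p'B); rewrite gen_subG; apply/fintype.subsetP=> x xS.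
have : x \in Q * B by rewrite defA mem_gen.
case/mulsgP=> q b qQ bB defx.
have cqb : commute q b.
  by apply: (centP (fintype.subsetP cQA _ qQ)); exact: (fintype.subsetP sBA).
move: xS; rewrite inE => /andP[_] /constt1P; rewrite defx.
rewrite consttM // (constt_p_elt (mem_p_elt pQ qQ)).
by have /constt1P-> := mem_p_elt p'B bB; rewrite mulg1 => ->; rewrite mul1g.
Qed.

Lemma pelt_compl_gen_p'elt : exists2 B : {group gT}, p.-group B &
  forall x, x \in H -> p.-elt x -> x \in B.
Proof.
have p'A := gen_p'elt_pgroup; have nAH := gen_p'elt_normal.
have hallA : p^'.-Hall(H) A.
  rewrite /pHall (normal_sub nAH) p'A -card_quotient ?normal_norm //=.
  rewrite -[pnat _ _]/(pgroup _ _); apply/pgroupP=> q pr_q /(Cauchy pr_q)[y].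
  case/morphimP=> x nAx xH -> ord_y.
  have xp'A : x.`_p^' \in A by rewrite mem_gen // inE p_elt_constt groupX.
  (* The p'-part of [x] dies modulo [A], so the quotient by [A] is a p-group and [A] is a Hall
     p'-subgroup. *)
  have : p.-elt (coset A x).
    have -> : coset A x = coset A x.`_p.
      rewrite -[in LHS](consttC p x) morphM ?groupX //.
      by have /= -> := coset_id xp'A; rewrite mulg1.
    by apply: morph_p_elt (p_elt_constt _ _); rewrite groupX.
  by rewrite /p_elt ord_y pnatE // !inE /= => /eqP->; rewrite eqxx.
have [B pB defH] := normal_Hall_compl hallA nAH.
exists B => [|x xH x_p].
  by move: pB; rewrite /pgroup pnatNK.
have : x \in A * B by rewrite defH.
case/mulsgP=> a b aA bB defx.
have bH : b \in H by rewrite -defH (fintype.subsetP (mulG_subr _ _)).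
have b_p : p.-elt b by rewrite -p_eltNK (mem_p_elt pB).
have cab : commute a b.
  by apply/commute_sym/(centP (pelt_cent_gen_p'elt bH b_p)).
suff a1 : a = 1 by rewrite defx a1 mul1g.
have := x_p; rewrite -p_eltNK => /constt1P; rewrite defx consttM //.
rewrite (constt_p_elt (mem_p_elt p'A aA)).
by have := b_p; rewrite -p_eltNK => /constt1P->; rewrite mulg1.
Qed.

(** Reordering commuting factors writes [x * y] as the product of [x.]_p * y.[_p], in a p-group, and
    [x.]_p^' * y.[_p^'], in the p'-group [A]. These commute, so they are the two parts of
    [x * y]. *)
Lemma constt_mul x y : x \in H -> y \in H ->
  (x * y).`_p = x.`_p * y.`_p /\ (x * y).`_p^' = x.`_p^' * y.`_p^'.
Proof.
move=> xH yH; have [B pB mB] := pelt_compl_gen_p'elt.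
have p'A := gen_p'elt_pgroup.
have mA z : z \in H -> z.`_p^' \in A.
  by move=> zH; rewrite mem_gen // inE p_elt_constt groupX.
have mpB z : z \in H -> z.`_p \in B.
  by move=> zH; rewrite mB ?p_elt_constt ?groupX.
have xy_p : p.-elt (x.`_p * y.`_p) by rewrite (mem_p_elt pB) ?groupM ?mpB.
have xy_p' : p^'.-elt (x.`_p^' * y.`_p^').
  by rewrite (mem_p_elt p'A) ?groupM ?mA.
have e : x * y = (x.`_p * y.`_p) * (x.`_p^' * y.`_p^').
  rewrite -[in LHS](consttC p x) -[in LHS](consttC p y) -!mulgA; congr (_ * _).
  rewrite !mulgA; congr (_ * _); apply/commute_sym/cHp;
  by rewrite ?p_elt_constt ?groupX.
have c : commute (x.`_p * y.`_p) (x.`_p^' * y.`_p^').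
  by apply: cHp; rewrite ?groupM ?groupX.
rewrite e !(consttM _ c) (constt_p_elt xy_p) (constt_p_elt xy_p').
have /constt1P-> := xy_p'; move: xy_p; rewrite -p_eltNK => /constt1P->.
by rewrite mulg1 mul1g.
Qed.

End CommutingParts.

Lemma constt_compl_mul (gT : finGroupType) (H : {group gT}) (pi : nat_pred) :
  (forall p x y, prime p -> p \in pi -> x \in H -> y \in H ->
     p.-elt x -> p^'.-elt y -> commute x y) ->
  {in H &, forall x y, (x * y).`_pi^' = x.`_pi^' * y.`_pi^'}.
Proof.
move=> cH.
(* The primes of [pi] are removed one at a time: passing from [s n] to [s n.+1] first takes the
   n'-part when [n] is a prime of [pi]. Primes above the group order do not matter. *)
pose s n := [pred p | [&& p < n, prime p & p \in pi]] : nat_pred.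
have sM n : {in H &, forall x y, (x * y).`_(s n)^' = x.`_(s n)^' * y.`_(s n)^'}.
  elim: n => [|n IHn] x y xH yH.
    have s0 z : z \in H -> z.`_(s 0)^' = z :> gT.
      move=> _; apply: constt_p_elt; apply/pgroupP => p _ _; by rewrite !inE.
    by rewrite !s0 ?groupM.
  have [/andP[pr_n n_pi]|bad_n] := boolP (prime n && (n \in pi)); last first.
    have sE z : z.`_(s n.+1)^' = z.`_(s n)^' :> gT.
      apply: eq_constt => p; rewrite !inE ltnS leq_eqVlt.
      by case: eqVneq => // ->; rewrite ltnn (negbTE bad_n).
    by rewrite !sE IHn.
  have sE z : z.`_(s n.+1)^' = z.`_n^'.`_(s n)^' :> gT.
    rewrite constt_constt; apply: eq_constt => p; rewrite !inE ltnS leq_eqVlt.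
    by case: eqVneq => //= ->; rewrite pr_n n_pi.
  have [_] := constt_mul (fun a b => cH n a b pr_n n_pi) xH yH.
  by rewrite !sE => ->; rewrite IHn ?groupX.
move=> x y xH yH.
have sE z : z.`_pi^' = z.`_(s #|gT|.+1)^' :> gT.
  apply: eq_in_constt => p; rewrite mem_primes !inE => /and3P[pr_p _ pz].
  by rewrite pr_p ltnS (leq_trans (dvdn_leq _ pz)) ?max_card.
by rewrite !sE sM.
Qed.

End FiniteGroups.

(** * Compact open subgroups and their finite quotients *)

Lemma finite_nat_bounded (A : set nat) :
  finite_set A -> exists n, forall k, A k -> k < n.
Proof.
move=> /finite_seqP[s ->]; exists (\max_(i <- s) i).+1 => k /= ks.
by rewrite ltnS leq_bigmax_seq.
Qed.

(** Otherwise the sets [V \ O] generate a proper filter on [K]. A cluster point lies in every closed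
    [V], hence in [O]; but then the neighbourhood [O] would have to meet [K \ O]. *)
Lemma compact_directed_sub (T : topologicalType) (K : set T)
    (F : set (set T)) (O : set T) :
  compact K -> F K -> (forall V, F V -> closed V) ->
  (forall V W, F V -> F W -> F (V `&` W)) ->
  open O -> \bigcap_(V in F) V `<=` O -> exists2 V, F V & V `<=` O.
Proof.
move=> cK FK clF FI oO sO; apply: contrapT => nex.
pose Phi := filter_from F (fun V => V `\` O).
have PPhi : ProperFilter Phi.
  apply: filter_from_proper.
    apply: filter_from_filter; first by exists K.
    move=> V W FV FW; exists (V `&` W); first exact: FI.
    by move=> x [[Vx Wx] nOx].
  move=> V FV; apply: contrapT => nV; apply: nex; exists V => // x Vx.
  by apply: contrapT => nOx; apply: nV; exists x.
have [|x [Kx clx]] := cK Phi PPhi; first by exists K => // x [].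
suff : O x.
  move=> /(conj oO)/open_nbhs_nbhs nO.
  have [|y [[_ nOy] Oy]] := clx (K `\` O) O _ nO.
    by exists K.
  exact: nOy.
apply: sO => V FV; apply: (clF _ FV) => W Wx.
have [|y [[Vy _] Wy]] := clx (V `\` O) W _ Wx; first by exists V.
by exists y.
Qed.

(** * Group laws, continuity and open subgroups *)

Section TopologicalGroups.
Variables (T : topologicalType) (G : tgroup T).
Hypothesis tG : is_topgroup G.
Local Notation "x ∙ y" := (tmul G x y) (at level 40, left associativity).
Local Notation inv := (tinv G).
Local Notation one := (tone G).

Let tmulA x y z : x ∙ (y ∙ z) = x ∙ y ∙ z. Proof. by case: tG. Qed.
Let tmul1 x : one ∙ x = x. Proof. by case: tG => _ /(_ x)[]. Qed.
Let tmulx1 x : x ∙ one = x. Proof. by case: tG => _ /(_ x)[]. Qed.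
Let tmulV x : inv x ∙ x = one. Proof. by case: tG => _ _ /(_ x)[]. Qed.
Let tmulxV x : x ∙ inv x = one. Proof. by case: tG => _ _ /(_ x)[]. Qed.

Lemma tmulK x y : inv x ∙ (x ∙ y) = y.
Proof. by rewrite tmulA tmulV tmul1. Qed.

Lemma tmulVK x y : x ∙ (inv x ∙ y) = y.
Proof. by rewrite tmulA tmulxV tmul1. Qed.

Lemma tmulxK x y : y ∙ x ∙ inv x = y.
Proof. by rewrite -tmulA tmulxV tmulx1. Qed.

Lemma tmulxVK x y : y ∙ inv x ∙ x = y.
Proof. by rewrite -tmulA tmulV tmulx1. Qed.

Lemma tinv_uniq x y : x ∙ y = one -> inv x = y.
Proof. by move=> xy; rewrite -[y](tmulK x) xy tmulx1. Qed.

Lemma tinvK x : inv (inv x) = x.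
Proof. exact/tinv_uniq/tmulV. Qed.

Lemma tinv1 : inv one = one.
Proof. exact/tinv_uniq/tmul1. Qed.

Lemma tinvM x y : inv (x ∙ y) = inv y ∙ inv x.
Proof. by apply: tinv_uniq; rewrite tmulA tmulxK tmulxV. Qed.

Lemma tdiv_eq1 x y : inv x ∙ y = one -> x = y.
Proof. by move=> /(congr1 (tmul G x)); rewrite tmulVK tmulx1. Qed.

Lemma comm_eq1 x y : comm G x y = one -> x ∙ y = y ∙ x.
Proof. by rewrite /comm -tinvM => /tdiv_eq1. Qed.

Let tdiv_cont : continuous (fun xy : T * T => xy.1 ∙ inv xy.2).
Proof. by case: tG. Qed.

Lemma tinv_cont : continuous inv.
Proof.
move=> x; have -> : inv = fun y => (one, y).1 ∙ inv (one, y).2.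
  by apply: funext => y; rewrite /= tmul1.
apply: (@continuous_comp _ _ _ (fun y => (one, y))
  (fun xy : T * T => xy.1 ∙ inv xy.2)); last exact: tdiv_cont.
by apply: cvg_pair; [exact: cvg_cst|exact: cvg_id].
Qed.

Lemma tmul_cont : continuous (fun xy : T * T => xy.1 ∙ xy.2).
Proof.
move=> x.
have -> : (fun xy : T * T => xy.1 ∙ xy.2) =
    fun y : T * T => (y.1, inv y.2).1 ∙ inv (y.1, inv y.2).2.
  by apply: funext => y; rewrite /= tinvK.
apply: (@continuous_comp _ _ _ (fun y : T * T => (y.1, inv y.2))
  (fun xy : T * T => xy.1 ∙ inv xy.2)); last exact: tdiv_cont.
apply: cvg_pair; first exact: cvg_fst.
by apply: (cvg_comp _ _ (@cvg_snd _ _ _ _ _)); exact: tinv_cont.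
Qed.

Lemma tmull_cont a : continuous (fun x => a ∙ x).
Proof.
move=> x; apply: (@continuous_comp _ _ _ (fun y => (a, y))
  (fun xy : T * T => xy.1 ∙ xy.2)); last exact: tmul_cont.
by apply: cvg_pair; [exact: cvg_cst|exact: cvg_id].
Qed.

Lemma tmulr_cont a : continuous (fun x => x ∙ a).
Proof.
move=> x; apply: (@continuous_comp _ _ _ (fun y => (y, a))
  (fun xy : T * T => xy.1 ∙ xy.2)); last exact: tmul_cont.
by apply: cvg_pair; [exact: cvg_id|exact: cvg_cst].
Qed.

Lemma nbhs_ldiv x N : nbhs one N -> nbhs x [set y | N (inv x ∙ y)].
Proof. by move=> N1; apply: (@tmull_cont (inv x)); rewrite /= tmulV. Qed.

Lemma nbhs_rdiv x N : nbhs one N -> nbhs x [set y | N (y ∙ inv x)].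
Proof. by move=> N1; apply: (@tmulr_cont (inv x)); rewrite /= tmulxV. Qed.

Lemma nbhs_lmul x O : nbhs x O -> nbhs one [set u | O (x ∙ u)].
Proof. by move=> Ox; apply: (@tmull_cont x); rewrite /= tmulx1. Qed.

Lemma nbhs_ldiv_sym x N : nbhs one N -> nbhs x [set y | N (inv y ∙ x)].
Proof.
move=> N1; have := @tinv_cont one; rewrite /continuous_at tinv1.
move=> /(_ N N1) /(@nbhs_ldiv x); apply: filterS => y /=.
by rewrite tinvM tinvK.
Qed.

Definition co_subgroup K := [/\ is_subgroup G K, compact K & open K].

Lemma gpow_sub H x n : is_subgroup G H -> H x -> H (gpow G x n).
Proof.
by case=> H1 HM _ Hx; elim: n => //= n IH; exact: HM.
Qed.

Lemma open_subgroup_closed H : is_subgroup G H -> open H -> closed H.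
Proof.
move=> sH oH x clx; have [H1 HM HV] := sH.
have /(nbhs_ldiv_sym x) /clx[y [Hy Hyx]] := open_nbhs_nbhs (conj oH H1).
by rewrite -(tmulVK y x); exact: HM.
Qed.

Lemma mono_closure_sub H x :
  is_subgroup G H -> open H -> H x -> mono_closure G x `<=` H.
Proof.
move=> sH oH Hx; have /closure_id cH := open_subgroup_closed sH oH.
rewrite [X in _ `<=` X]cH; apply: closureS => y [[n|n] ->] /=.
  exact: gpow_sub.
by have [_ _ HV] := sH; apply/HV; exact: (gpow_sub n.+1).
Qed.

Lemma subgroup_open H : is_subgroup G H -> nbhs one H -> open H.
Proof.
move=> [_ HM _] H1; rewrite openE => x Hx.
apply: filterS (nbhs_ldiv x H1) => y /= Hxy.
by rewrite -(tmulVK x y); exact: HM.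
Qed.

(* Take the right stabilizer of [V]: it is contained in [V] because [V]
   contains the identity, and open because [V] is compact and open. *)
Lemma compact_open_subgroup V : compact V -> open V -> V one ->
  exists2 N, is_subgroup G N /\ open N & N `<=` V.
Proof.
move=> cV oV V1.
pose N := [set x | forall v, V v -> V (v ∙ x) /\ V (v ∙ inv x)].
have sN : is_subgroup G N.
  split=> [v Vv|x y Nx Ny v Vv|x Nx v Vv].
  - by rewrite tinv1 tmulx1.
  - rewrite tinvM !tmulA; split.
      by apply: (Ny _ _).1; exact: (Nx _ Vv).1.
    by apply: (Nx _ _).2; exact: (Ny _ Vv).2.
  - by rewrite tinvK; split; [apply: (Nx _ Vv).2|apply: (Nx _ Vv).1].
exists N; last by move=> x /(_ _ V1)[]; rewrite tmul1.
split=> //; apply: subgroup_open => //.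
have := (compact_near_coveringP V).1 cV T (nbhs one)
  (fun x v => V (v ∙ x) /\ V (v ∙ inv x)) _.
apply=> v Vv.
have nV : nbhs (v ∙ one) V by rewrite tmulx1; exact: open_nbhs_nbhs.
have nV' : nbhs (v ∙ inv one) V by rewrite tinv1.
apply: filterI; first exact: (@tmul_cont (v, one)).
exact: (@tdiv_cont (v, one)).
Qed.

(** * Separation and small open subgroups *)

Hypothesis perG : periodic_group G.

Lemma closed_tone : closed [set one].
Proof.
have [_ tdG _] := perG; have <- := tdG one I.
by apply: component_closed; exact: closedT.
Qed.

(** If [x] and [y] differ, continuity of division keeps the quotient away from [one] on some [A]
    times [B] around [(x, y)]; such [A] and [B] are disjoint. *)
Lemma tgroup_hausdorff : hausdorff_space T.
Proof.
move=> x y xy; apply: contrapT => neq.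
have : nbhs (x ∙ inv y) (~` [set one]).
  apply: open_nbhs_nbhs; split; first exact/closed_openC/closed_tone.
  by move=> /(congr1 (fun z => z ∙ y)); rewrite tmulxVK tmul1.
move=> /(@tdiv_cont (x, y))[[A B] /= [Ax By] AB].
have [z [Az Bz]] := xy A B Ax By.
by have /= := AB (z, z) (conj Az Bz); rewrite tmulxV.
Qed.

(** Quasi-components are connected in a compact Hausdorff space. Together with total
    disconnectedness this yields a clopen basis at [one]. *)
Lemma quasi_component_connected (K : set T) x :
  compact K -> open K -> K x ->
  connected (\bigcap_(V in [set V | [/\ clopen V, V `<=` K & V x]]) V).
Proof.
move=> cK oK Kx; set F := [set V | _]; set Q := \bigcap_(V in F) V.
have clK : closed K := compact_closed tgroup_hausdorff cK.
have QK : Q `<=` K by move=> y; apply; split.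
have FK : F K by split.
have Fcl V : F V -> closed V by case=> [[]].
have clQ : closed Q by apply: closed_bigI => V /Fcl.
have FI V W : F V -> F W -> F (V `&` W).
  move=> [cV VK Vx] [cW _ Wx]; split=> //; first exact: clopenI.
  by move=> y [/VK].
have sep A B : closed A -> closed B -> A `&` B = set0 -> A `|` B = Q -> A x ->
    B = set0.
  move=> clA clB AB0 AB Ax.
  (* Normality gives an open [C'] around [A] whose closure misses [B]. Some [V] in [F] avoids the
     boundary of [C'], so [V] meets [C'] in a clopen set of [F], and [Q] lies inside it. *)
  have AK : A `<=` K°.
    by rewrite ((interior_id K).1 oK) => y Ay; apply: QK; rewrite -AB; left.
  have nAB : set_nbhs A (~` B).
    apply/set_nbhsP; exists (~` B); split=> //; first exact: closed_openC.
    exact/disjoints_subset.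
  have [C /set_nbhsP[C' [oC' AC' C'C]] CB] :=
    compact_normal_local tgroup_hausdorff cK AK clA nAB.
  have C'cl : C' `<=` closure C := subset_trans C'C (@subset_closure _ C).
  have [||V FV VW] := compact_directed_sub (O := C' `|` ~` closure C)
    cK FK Fcl FI.
  - by apply: openU => //; exact/closed_openC/closed_closure.
  - rewrite -/Q -AB => y [Ay|By]; [left; exact: AC'|right=> /CB; exact].
  have V'E : V `&` C' = V `&` closure C.
    apply/seteqP; split=> y [Vy Cy]; split=> //; first exact: C'cl.
    by case: (VW _ Vy).
  suff FV' : F (V `&` C').
    apply/seteqP; split=> // y By.
    have /(_ _ FV')[_ /C'cl/CB] : Q y by rewrite -AB; right.
    exact.
  have [[oV clV] VK Vx] := FV; split.
  - split; first exact: openI.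
    by rewrite V'E; apply: closedI => //; exact: closed_closure.
  - by move=> y [/VK].
  - by split=> //; exact: AC'.
move=> B [b Bb] [U oU BU] [C clC BC].
(* [B] and its complement in [Q] are both closed; [sep] shows that the one without [x] is empty. *)
have clB : closed B by rewrite BC; exact: closedI.
have clB' : closed (Q `&` ~` U) by apply: closedI => //; exact: open_closedC.
have BB' : B `&` (Q `&` ~` U) = set0.
  by rewrite BU; apply/seteqP; split=> // y [[_ Uy] [_ /(_ Uy)]].
have BUB' : B `|` (Q `&` ~` U) = Q by rewrite BU -setIUr setUv setIT.
have Qx : Q x by move=> V [].
have [Bx|nBx] := pselect (B x).
  by rewrite -BUB' (sep _ _ clB clB') // setU0.
suff B0 : B = set0 by move: Bb; rewrite B0.
apply: (sep _ _ clB' clB); [by rewrite setIC|by rewrite setUC|].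
by split=> // Ux; apply: nBx; rewrite BU.
Qed.

Lemma clopen_basis K O : compact K -> open K -> K one -> open O -> O one ->
  exists V, [/\ clopen V, V `<=` K, V one & V `<=` O].
Proof.
move=> cK oK K1 oO O1.
have [|||||V [cV VK V1] VO] := compact_directed_sub (O := O)
  (F := [set V | [/\ clopen V, V `<=` K & V one]]) cK.
- by split=> //; split=> //; exact: compact_closed tgroup_hausdorff cK.
- by move=> V [[]].
- move=> V W [cV VK V1] [cW _ W1]; split=> //; first exact: clopenI.
  by move=> y [/VK].
- exact: oO.
- have [_ tdG _] := perG; move=> y Qy.
  suff -> : y = one by [].
  have : connected_component [set: T] one y.
    have cQ := quasi_component_connected cK oK K1.
    by apply: connected_component_max cQ _ Qy => // V [].
  by rewrite tdG.
by exists V.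
Qed.

(** This is van Dantzig's theorem: a clopen neighbourhood of [one] inside [K] is compact, so it
    contains an open subgroup. *)
Lemma open_subgroup_basis K O : compact K -> open K -> K one -> nbhs one O ->
  exists2 N, is_subgroup G N /\ open N & N `<=` K `&` O.
Proof.
move=> cK oK K1; rewrite nbhsE => -[U [oU U1] UO].
have [V [[oV clV] VK V1 VO]] := clopen_basis cK oK K1 oU U1.
have [N sN NV] := compact_open_subgroup (subclosed_compact clV cK VK) oV V1.
by exists N => // x /NV Vx; split; [exact: VK|exact/UO/VO].
Qed.

(** Local constancy replaces continuity into a discrete group. Values outside [K] are arbitrary, and
    [f] need not be onto. *)
Definition finite_quotient (K : set T) (gT : finGroupType) (f : T -> gT) :=
  (forall x y, K x -> K y -> f (x ∙ y) = (f x * f y)%g) /\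
  (forall x, K x -> \forall y \near x, K y /\ f y = f x).

(* [f] is the action of [K] by right translations on the right cosets of [N];
   the coset of [x] is encoded by the position of the first element of [s]
   representing it, so indices that are not such a position are fixed. *)
Lemma coset_action K N : co_subgroup K -> is_subgroup G N -> open N ->
    N `<=` K ->
  exists m (f : T -> 'S_m), finite_quotient K f /\
    forall x, K x -> f x = 1%g -> N x.
Proof.
move=> [sK cK oK] sN oN NK; have [K1 KM KV] := sK; have [N1 NM NV] := sN.
have nN1 : nbhs one N by exact: open_nbhs_nbhs.
have oNd d : open [set y | N (y ∙ inv d)].
  apply: (@open_comp _ _ (fun y => y ∙ inv d) N) => // y _.
  exact: tmulr_cont.
pose PT : ptopologicalType := HB.pack T (isPointed.Build T one).
have covK : cover_compact (K : set PT) by rewrite -compact_cover.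
have sK_cov : K `<=` cover K (fun d => [set y | N (y ∙ inv d)]).
  by move=> x Kx; exists x => //=; rewrite tmulxV.
have [D' D'K Kcov] := covK T K _ (fun d _ => oNd d) sK_cov.
pose s : seq T := finmap.enum_fset D'.
pose E x d := `[< N (x ∙ inv d) >].
pose c x := find (E x) s.
have cE x y : N (x ∙ inv y) -> c x = c y.
  move=> Nxy; apply: eq_find => d; rewrite /E; apply: asbool_equiv_eq; split.
    by move=> /(NM _ _ (NV _ Nxy)); rewrite tinvM tinvK tmulA tmulxVK.
  by move=> /(NM _ _ Nxy); rewrite tmulA tmulxVK.
have hs x : K x -> has (E x) s.
  move=> /Kcov[d /= dD' Nxd]; apply/hasP; exists d => //; exact/asboolP.
have cs x : K x -> c x < size s by move=> /hs; rewrite has_find.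
pose r i := nth one s i.
have rK i : i < size s -> K (r i) by move=> /(mem_nth one) /D'K/set_mem.
have cr x : K x -> N (x ∙ inv (r (c x))).
  by move=> /hs/(nth_find one)/asboolP.
have crx x y : K x -> c (r (c x) ∙ y) = c (x ∙ y).
  move=> Kx; apply/esym/cE; rewrite tinvM tmulA tmulxK; exact: cr.
have cN x y : K x -> K y -> c x = c y -> N (x ∙ inv y).
  move=> Kx Ky cxy; have := NM _ _ (cr _ Kx) (NV _ (cr _ Ky)).
  by rewrite cxy tinvM tinvK tmulA tmulxVK.
pose m := size s.
pose g x (i : nat) := if c (r i) == i then c (r i ∙ x) else i.
have gm x i : K x -> i < m -> g x i < m.
  by move=> Kx im; rewrite /g; case: ifP => // _; apply/cs/KM => //; exact: rK.
have gc x y : K y -> g x (c y) = c (y ∙ x).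
  move=> Ky; have := crx y one Ky; rewrite !tmulx1 /g => ->.
  by rewrite eqxx crx.
have gM x y i : K x -> i < m -> g y (g x i) = g (x ∙ y) i.
  move=> Kx im; have [ci|nci] := eqVneq (c (r i)) i.
    by have Kr := rK _ im; rewrite -ci !gc ?tmulA //; exact: KM.
  by rewrite {2}/g (negbTE nci) /g (negbTE nci).
have g1 i : g one i = i.
  by rewrite /g; case: eqP => // ci; rewrite tmulx1.
have /choice[f fE] : forall x, exists f : 'S_m, K x ->
    forall i, f i = g x i :> nat.
  move=> x; have [Kx|] := pselect (K x); last by exists 1%g.
  pose h (i : 'I_m) : 'I_m := Ordinal (gm x i Kx (ltn_ord i)).
  have hI : injective h.
    move=> i j /(congr1 val) /= /(congr1 (g (inv x))).
    by rewrite !gM // tmulxV !g1 => /val_inj.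
  by exists (perm hI) => _ i; rewrite permE.
exists m, f; split; last first.
  move=> x Kx fx1; have := fE _ Kx (Ordinal (cs _ K1)).
  rewrite fx1 perm1 /= gc // tmul1 => /esym/(cN _ _ Kx K1).
  by rewrite tinv1 tmulx1.
split=> [x y Kx Ky|x Kx].
  apply/permP=> i; apply: val_inj; rewrite /= permM fE ?fE ?gM //.
  exact: KM.
(* If [y ∙ inv x] lies in the finitely many conjugates of [N] by the representatives, then [x] and
   [y] move every coset alike. *)
have : \forall y \near x, forall i : 'I_m,
    N (r i ∙ (y ∙ inv x) ∙ inv (r i)).
  apply: filter_forall => i.
  apply: (@nbhs_rdiv x [set u | N (r i ∙ u ∙ inv (r i))]).
  apply: (@tmull_cont (r i) one [set u | N (u ∙ inv (r i))]).
  by rewrite tmulx1; exact: nbhs_rdiv.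
have : nbhs x K by exact: open_nbhs_nbhs.
apply: filterS2 => y Ky Nyx; split=> //; apply/permP=> i; apply: val_inj.
rewrite /= !fE // /g; case: ifP => // _.
apply: cE; have := Nyx i; by rewrite tinvM !tmulA.
Qed.

Section FiniteQuotients.
Variables (K : set T) (gT : finGroupType) (f : T -> gT).
Hypotheses (sK : is_subgroup G K) (fqf : finite_quotient K f).

Lemma fq_one : f one = 1%g.
Proof.
have [K1 _ _] := sK; have [fM _] := fqf.
by apply: (mulgI (f one)); rewrite -fM // tmul1 mulg1.
Qed.

Lemma fq_inv x : K x -> f (inv x) = (f x)^-1%g.
Proof.
move=> Kx; have [_ _ KV] := sK; have [fM _] := fqf.
by apply: (mulgI (f x)); rewrite -fM ?tmulxV ?mulgV ?fq_one //; exact: KV.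
Qed.

Lemma fq_gpow x n : K x -> f (gpow G x n) = (f x ^+ n)%g.
Proof.
move=> Kx; have [fM _] := fqf; elim: n => [|n IHn]; first exact: fq_one.
by rewrite expgS -IHn -fM //; exact: gpow_sub.
Qed.

(** As [f] is locally constant, [y] has the same image as some power of [x] close to it. *)
Lemma fq_mono_closure x y : open K -> K x -> mono_closure G x y ->
  f y \in <[f x]>%g.
Proof.
move=> oK Kx yx; have Ky := mono_closure_sub sK oK Kx yx.
have [_ /(_ _ Ky)/yx[z [[k ->] [Kz <-]]]] := fqf.
have [_ _ KV] := sK.
case: k {Kz} => n /=; first by rewrite fq_gpow // mem_cycle.
rewrite fq_inv ?groupV; first by rewrite (fq_gpow n.+1) // mem_cycle.
exact: (gpow_sub n.+1).
Qed.

Let im := [set h | `[< exists2 x, K x & f x = h >]]%SET.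

Lemma fq_image_group : group_set im.
Proof.
have [K1 KM _] := sK; have [fM _] := fqf.
apply/group_setP; split=> [|a b].
  by rewrite inE; apply/asboolP; exists one => //; exact: fq_one.
rewrite !inE => /asboolP[x Kx <-] /asboolP[y Ky <-]; apply/asboolP.
by exists (x ∙ y); [exact: KM|exact: fM].
Qed.

(** The commutation hypotheses of the finite lemmas can only be checked on values of [f], so those
    lemmas are applied to this image. *)
Definition fq_image := Group fq_image_group.

Lemma fq_imageP h : reflect (exists2 x, K x & f x = h) (h \in fq_image).
Proof. by rewrite inE; apply: (iffP (asboolP _)). Qed.

Lemma mem_fq_image x : K x -> f x \in fq_image.
Proof. by move=> Kx; apply/fq_imageP; exists x. Qed.

End FiniteQuotients.

(** If [x] and [y] differ, some open subgroup [N] of [K] misses [inv x ∙ y]; the action on the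
    cosets of [N] has its kernel in [N] and separates them. *)
Lemma fq_eq K x y : co_subgroup K -> K x -> K y ->
  (forall (gT : finGroupType) (f : T -> gT),
     finite_quotient K f -> f x = f y) ->
  x = y.
Proof.
move=> coK Kx Ky fxy; have [sK cK oK] := coK; have [K1 KM KV] := sK.
apply: contrapT => neq.
have [|N [sN oN] NO] := @open_subgroup_basis K (~` [set inv x ∙ y]) cK oK K1.
  apply: open_nbhs_nbhs; split; last by move=> /esym/tdiv_eq1.
  exact/closed_openC/accessible_closed_set1/hausdorff_accessible/tgroup_hausdorff.
have NK : N `<=` K by move=> z /NO[].
have [m [f [fqf kerf]]] := coset_action coK sN oN NK.
have /NO[_] : N (inv x ∙ y); last exact.
apply: kerf; first by apply: KM => //; exact: KV.
have [fM _] := fqf; rewrite fM // ?(fq_inv sK) //; last exact: KV.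
by rewrite (fxy _ _ fqf) mulVg.
Qed.

Definition is_pi_part (pi : nat_pred) x y := mono_closure G x y /\
  forall K (gT : finGroupType) (f : T -> gT),
    co_subgroup K -> K x -> finite_quotient K f -> f y = ((f x).`_pi)%g.

Lemma pi_part_exists (pi : nat_pred) x : exists y, is_pi_part pi x y.
Proof.
(* The exponent [a n] is 1 modulo the pi-part of [n!] and 0 modulo its pi'-part. In any finite
   quotient the order of [f x] divides [n!] for large [n], and then the power is the pi-part of
   [f x]. *)
pose a n := chinese (n`!`_pi)%N (n`!`_pi^')%N 1 0.
have [_ _ /(_ x) cx] := perG.
have PF : ProperFilter ((fun n => gpow G x (a n)) @ \oo).
  exact: fmap_proper_filter.
have [|y [xy cly]] := cx _ PF.
  by exists 0%N => // n _; apply: subset_closure; exists (Posz (a n)).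
exists y; split=> // K gT f [sK cK oK] Kx fqf.
have Ky := mono_closure_sub sK oK Kx xy.
have [_ /(_ _ Ky) ny] := fqf.
suff ev : \forall n \near \oo, f (gpow G x (a n)) = ((f x).`_pi)%g.
  by have [z [/= <- [_ ->]]] := cly [set z | f z = ((f x).`_pi)%g] _ ev ny.
near=> n; rewrite (fq_gpow sK fqf) //.
have fx_n : #[f x]%g %| n`!.
  by rewrite dvdn_fact // order_gt0 /=; near: n; exact: nbhs_infty_ge.
have cop : coprime (n`!`_pi)%N (n`!`_pi^')%N by rewrite coprime_partC.
apply: expg_eq_constt.
  have d := partn_dvd pi (fact_gt0 n) fx_n.
  by rewrite -(modn_dvdm (a n) d) chinese_modl // modn_dvdm.
apply: dvdn_trans (partn_dvd pi^'%N (fact_gt0 n) fx_n) _.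
by rewrite /dvdn chinese_modr // mod0n.
Unshelve. all: by end_near. Qed.

(** * Parts of elements of a periodic group *)

Hypothesis crG : compactly_ruled G.

Lemma co_subgroup_exists x : exists2 K, co_subgroup K & K x.
Proof.
have [F [Fco _ FT]] := crG.
have [K FK Kx] : (\bigcup_(U in F) U) x by rewrite FT.
by exists K => //; exact: Fco.
Qed.

Lemma co_subgroup_exists2 x y : exists K, [/\ co_subgroup K, K x & K y].
Proof.
have [F [Fco Fdir FT]] := crG.
have [K FK Kx] : (\bigcup_(U in F) U) x by rewrite FT.
have [L FL Ly] : (\bigcup_(U in F) U) y by rewrite FT.
have [M [FM KM LM]] := Fdir _ _ FK FL.
by exists M; split; [exact: Fco|exact: KM|exact: LM].
Qed.

Definition pi_part (pi : nat_pred) x := xget one (is_pi_part pi x).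

Lemma pi_part_mono pi x : mono_closure G x (pi_part pi x).
Proof. by have [] := xgetPex one (pi_part_exists pi x). Qed.

Lemma pi_part_fq K (gT : finGroupType) (f : T -> gT) pi x :
  co_subgroup K -> finite_quotient K f -> K x ->
  f (pi_part pi x) = ((f x).`_pi)%g.
Proof.
move=> coK fqf Kx; have [_] := xgetPex one (pi_part_exists pi x).
by move=> /(_ _ _ f coK Kx fqf).
Qed.

Lemma pi_part_sub K pi x : co_subgroup K -> K x -> K (pi_part pi x).
Proof.
by move=> [sK _ oK] Kx; apply: (mono_closure_sub sK oK Kx); exact: pi_part_mono.
Qed.

(** This is the transfer principle: identities between parts need only be checked in finite
    groups. *)
Lemma pi_part_uniq K pi x y : co_subgroup K -> K x -> K y ->
  (forall (gT : finGroupType) (f : T -> gT),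
     finite_quotient K f -> f y = ((f x).`_pi)%g) -> pi_part pi x = y.
Proof.
move=> coK Kx Ky fy; apply: (fq_eq coK) => //; first exact: pi_part_sub.
by move=> gT f fqf; rewrite (pi_part_fq _ coK fqf Kx) fy.
Qed.

Lemma co_subgroup_basis K O : co_subgroup K -> nbhs one O ->
  exists m (f : T -> 'S_m), finite_quotient K f /\
    forall x, K x -> f x = 1%g -> O x.
Proof.
move=> coK O1; have [sK cK oK] := coK; have [K1 _ _] := sK.
have [N [sN oN] NO] := open_subgroup_basis cK oK K1 O1.
have [|m [f [fqf kerf]]] := coset_action coK sN oN; first by move=> x /NO[].
by exists m, f; split=> // x Kx fx1; have [] := NO _ (kerf _ Kx fx1).
Qed.

Lemma fq_ldiv K (gT : finGroupType) (f : T -> gT) x y : co_subgroup K ->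
  finite_quotient K f -> K x -> K y ->
  K (inv x ∙ y) /\ f (inv x ∙ y) = ((f x)^-1 * f y)%g.
Proof.
move=> [sK _ _] fqf Kx Ky; have [_ KM KV] := sK; have [fM _] := fqf.
split; first by apply: KM => //; exact: KV.
by rewrite fM // ?(fq_inv sK fqf) //; exact: KV.
Qed.

(** If [f z = f x], the parts of [x] and [z] also agree under [f], hence differ by an element of the
    kernel, which can be taken small. *)
Lemma pi_part_cont pi : continuous (pi_part pi).
Proof.
move=> x O Ox; have [K coK Kx] := co_subgroup_exists x.
have [m [f [fqf kerf]]] := co_subgroup_basis coK (nbhs_lmul Ox).
have [_ /(_ _ Kx)] := fqf; apply: filterS => z [Kz fzx] /=.
have [Kd fd] := fq_ldiv coK fqf (pi_part_sub pi coK Kx) (pi_part_sub pi coK Kz).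
rewrite -[pi_part pi z](tmulVK (pi_part pi x)); apply: kerf => //.
by rewrite fd !(pi_part_fq _ coK fqf) // fzx mulVg.
Qed.

Lemma pi_part_primary q x : prime q -> primary_comp G x q (pi_part q x).
Proof.
move=> pr_q; split; first exact: pi_part_mono.
move=> O O1; have [K coK Kx] := co_subgroup_exists x.
have [sK cK oK] := coK; have Ky := pi_part_sub q coK Kx.
have [m [f [fqf kerf]]] := co_subgroup_basis coK O1.
have [k ordk] : {k | #[f (pi_part q x)]%g = (q ^ k)%N}.
  by apply: p_natP; rewrite (pi_part_fq _ coK fqf Kx) -/(p_elt _ _) p_elt_constt.
exists k => // n /= kn; apply: kerf; first exact: gpow_sub.
rewrite (fq_gpow sK fqf) //; apply/eqP.
by rewrite -order_dvdn ordk dvdn_exp2l.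
Qed.

(** The q-part is itself in the q-primary component. Conversely, if it is trivial, the image of any
    [y] in that component is a q'-element, as it lies in the cyclic group of [f x], and a q-element,
    as some power with exponent [q ^ n] vanishes. *)
Lemma primary_comp_trivial q x : prime q ->
  primary_comp G x q = [set one] <-> pi_part q x = one.
Proof.
move=> pr_q; split=> [xq|xq].
  by have := pi_part_primary x pr_q; rewrite xq.
have [K coK Kx] := co_subgroup_exists x; have [sK cK oK] := coK.
have [K1 _ _] := sK.
apply/seteqP; split=> [y [xy cy]|_ ->]; last first.
  split; first by apply: subset_closure; exists (Posz 0).
  have gpow1 n : gpow G one n = one by elim: n => //= n ->; rewrite tmul1.
  by under eq_fun do rewrite gpow1; exact: cvg_cst.
have Ky := mono_closure_sub sK oK Kx xy.
apply: (fq_eq coK) => // gT f fqf.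
have f1 := fq_one sK fqf; rewrite f1.
have q'x : q^'.-elt%g (f x).
  by apply/constt1P; rewrite -(pi_part_fq _ coK fqf Kx) xq.
have q'y : q^'.-elt%g (f y).
  by apply: mem_p_elt q'x (fq_mono_closure sK fqf oK Kx xy).
have [_ /(_ _ K1)/cy[n _ /(_ n (leqnn n))[_]]] := fqf.
rewrite f1 (fq_gpow sK fqf) // => /eqP; rewrite -order_dvdn => yq.
have q_y : q.-elt%g (f y) by apply: pnat_dvd yq _; rewrite pnatX pnat_id.
by rewrite -(constt_p_elt q_y); apply/constt1P.
Qed.

(** * Sets of sigma-elements as kernels of part maps *)

Lemma sigma_elt_pdiv (s : set nat) x K (gT : finGroupType) (f : T -> gT) :
  G_sigma G s x -> co_subgroup K -> finite_quotient K f -> K x ->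
  forall q, prime q -> q %| #[f x]%g -> s q.
Proof.
move=> sx coK fqf Kx q pr_q qx; apply: contrapT => nsq.
have /(primary_comp_trivial _ pr_q) xq := sx q pr_q nsq.
have : q^'.-elt%g (f x).
  apply/constt1P; rewrite -(pi_part_fq _ coK fqf Kx) xq.
  by have [sK _ _] := coK; rewrite (fq_one sK fqf).
by move=> /pnatP-/(_ (order_gt0 _) q pr_q qx); rewrite !inE eqxx.
Qed.

Lemma G_pP p x : prime p -> G_p G p x <-> pi_part p^'%N x = one.
Proof.
move=> pr_p; have [K coK Kx] := co_subgroup_exists x; have [sK _ _] := coK.
have [K1 _ _] := sK; split=> [px|px q pr_q /= qp].
  apply: (pi_part_uniq coK) => // gT f fqf; rewrite (fq_one sK fqf).
  apply/esym/constt1P; rewrite p_eltNK; apply/pnatP => // q pr_q qx.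
  by rewrite !inE (sigma_elt_pdiv px coK fqf Kx pr_q qx).
apply/primary_comp_trivial => //; apply: (pi_part_uniq coK) => // gT f fqf.
rewrite (fq_one sK fqf); apply/esym/constt1P.
have : p.-elt%g (f x).
  rewrite -p_eltNK; apply/constt1P; rewrite -(pi_part_fq _ coK fqf Kx) px.
  exact: fq_one fqf.
by apply: sub_p_elt => r; rewrite !inE => /eqP ->; apply/eqP => /esym.
Qed.

Lemma G_pcomplP p x : prime p -> G_sigma G (pcompl p) x <-> pi_part p x = one.
Proof.
move=> pr_p; split=> [px|px q pr_q nq].
  by apply/primary_comp_trivial => //; apply: px => // -[].
have -> : q = p by apply: contrapT => qp; exact: nq.
exact/primary_comp_trivial.
Qed.

Lemma G_nu'P x : G_sigma G (nu' G) x <->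
  forall p, nu G p -> pi_part p x = one.
Proof.
split=> [xn p np|xn q pr_q nq].
  have [pr_p _] := np.
  by apply/primary_comp_trivial => //; apply: xn => // -[].
apply/primary_comp_trivial => //; apply: xn.
by apply: contrapT => nuq; exact: nq.
Qed.

Let nup : nat_pred := [pred q | `[< nu G q >]].

Lemma G_p_pelt p x K (gT : finGroupType) (f : T -> gT) :
  G_p G p x -> co_subgroup K -> finite_quotient K f -> K x -> p.-elt%g (f x).
Proof.
move=> px coK fqf Kx; apply/pnatP => // q pr_q qx.
by rewrite inE (sigma_elt_pdiv px coK fqf Kx pr_q qx).
Qed.

Lemma G_nu'_elt x K (gT : finGroupType) (f : T -> gT) :
  G_sigma G (nu' G) x -> co_subgroup K -> finite_quotient K f -> K x ->
  nup^'.-elt%g (f x).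
Proof.
move=> px coK fqf Kx; apply/pnatP => // q pr_q qx.
rewrite !inE; apply/asboolP.
by have [] := sigma_elt_pdiv px coK fqf Kx pr_q qx.
Qed.

Lemma pi_part_G_p p x : prime p -> G_p G p (pi_part p x).
Proof.
move=> pr_p; apply/G_pP => //.
have [K coK Kx] := co_subgroup_exists x; have [sK _ _] := coK.
have [K1 _ _] := sK.
apply: (pi_part_uniq coK) => //; first exact: pi_part_sub.
move=> gT f fqf; rewrite (fq_one sK fqf) (pi_part_fq _ coK fqf Kx).
by apply/esym/constt1P; rewrite p_eltNK p_elt_constt.
Qed.

Lemma pi_part_pcompl p x : prime p -> G_sigma G (pcompl p) (pi_part p^'%N x).
Proof.
move=> pr_p; apply/G_pcomplP => //.
have [K coK Kx] := co_subgroup_exists x; have [sK _ _] := coK.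
have [K1 _ _] := sK.
apply: (pi_part_uniq coK) => //; first exact: pi_part_sub.
move=> gT f fqf; rewrite (fq_one sK fqf) (pi_part_fq _ coK fqf Kx).
by apply/esym/constt1P; rewrite p_elt_constt.
Qed.

Lemma pi_part_G_nu' x : G_sigma G (nu' G) (pi_part nup^'%N x).
Proof.
apply/G_nu'P => p np.
have [K coK Kx] := co_subgroup_exists x; have [sK _ _] := coK.
have [K1 _ _] := sK.
apply: (pi_part_uniq coK) => //; first exact: pi_part_sub.
move=> gT f fqf; rewrite (fq_one sK fqf) (pi_part_fq _ coK fqf Kx).
apply/esym/constt1P; apply: sub_p_elt (p_elt_constt _ _) => q.
by rewrite !inE; apply: contraNN => /eqP ->; apply/asboolP.
Qed.

(** * Multiplicativity of the parts *)

Section MultiplicativeParts.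
Variables (K : set T) (gT : finGroupType) (f : T -> gT).
Hypotheses (coK : co_subgroup K) (fqf : finite_quotient K f).

(** The p-element [f x] is also the image of the p-part of [x], and [f y] that of the p'-part of
    [y]; these parts commute in [G] by the definition of [nu]. *)
Lemma nu_commute p x y : nu G p -> K x -> K y ->
  p.-elt%g (f x) -> p^'.-elt%g (f y) -> commute (f x) (f y).
Proof.
move=> [pr_p cp] Kx Ky fx fy; have [sK _ _] := coK; have [fM _] := fqf.
have Kx' := pi_part_sub p coK Kx; have Ky' := pi_part_sub p^'%N coK Ky.
have /comm_eq1/(congr1 f) :=
  cp _ _ (pi_part_G_p x pr_p) (pi_part_pcompl y pr_p).
by rewrite !fM // !(pi_part_fq _ coK fqf) // !constt_p_elt.
Qed.

Let sK : is_subgroup G K. Proof. by case: coK. Qed.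

Lemma fq_constt_mul p x y : nu G p -> K x -> K y ->
  ((f (x ∙ y)).`_p = (f x).`_p * (f y).`_p)%g /\
  ((f (x ∙ y)).`_p^' = (f x).`_p^' * (f y).`_p^')%g.
Proof.
move=> np Kx Ky; have [fM _] := fqf; rewrite fM //.
apply: (@constt_mul _ (fq_image sK fqf)); try exact: mem_fq_image.
by move=> _ _ /fq_imageP[a Ka <-] /fq_imageP[b Kb <-]; exact: nu_commute.
Qed.

Lemma fq_constt_nu'_mul x y : K x -> K y ->
  ((f (x ∙ y)).`_nup^' = (f x).`_nup^' * (f y).`_nup^')%g.
Proof.
move=> Kx Ky; have [fM _] := fqf; rewrite fM //.
apply: (@constt_compl_mul _ (fq_image sK fqf)); try exact: mem_fq_image.
move=> p _ _ _ /asboolP np /fq_imageP[a Ka <-] /fq_imageP[b Kb <-].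
exact: nu_commute.
Qed.

Lemma fq_eq1 u : K u -> (forall p, nu G p -> ((f u).`_p = 1)%g) ->
  ((f u).`_nup^' = 1)%g -> f u = 1%g.
Proof.
move=> Ku fu_p /constt1P; rewrite p_eltNK => fu_nu.
apply/eqP; rewrite -order_eq1.
have [le1|/pdivP[q pr_q q_fu]] := leqP #[f u]%g 1.
  by rewrite eqn_leq le1 order_gt0.
have /pnatP-/(_ (order_gt0 _) q pr_q q_fu)/asboolP nq := fu_nu.
have /constt1P/pnatP-/(_ (order_gt0 _) q pr_q q_fu) := fu_p q nq.
by rewrite !inE eqxx.
Qed.

(** Only finitely many primes matter in a given finite quotient; this is the source of both
    finiteness conditions of the local product. *)
Lemma fq_large_part p u : prime p -> #|gT| < p -> K u -> f (pi_part p u) = 1%g.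
Proof.
move=> pr_p lt_p Ku; rewrite (pi_part_fq _ coK fqf) //.
apply/constt1P/pnatP => // q _ /dvdn_leq-/(_ (order_gt0 _)) le_q.
rewrite !inE; apply: contraTneq lt_p => <-.
by rewrite -leqNgt (leq_trans le_q) // max_card.
Qed.

End MultiplicativeParts.

Lemma pi_part_mul_of (pi : nat_pred) :
  (forall K (gT : finGroupType) (f : T -> gT), co_subgroup K ->
     finite_quotient K f -> forall x y, K x -> K y ->
     ((f (x ∙ y)).`_pi = (f x).`_pi * (f y).`_pi)%g) ->
  forall x y, pi_part pi (x ∙ y) = pi_part pi x ∙ pi_part pi y.
Proof.
move=> piM x y; have [K [coK Kx Ky]] := co_subgroup_exists2 x y.
have [[_ KM _] _ _] := coK.
have [Kx' Ky'] := (pi_part_sub pi coK Kx, pi_part_sub pi coK Ky).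
apply: (pi_part_uniq coK) => //; try exact: KM.
move=> gT f fqf; have [fM _] := fqf.
by rewrite fM // !(pi_part_fq _ coK fqf) // (piM K).
Qed.

Lemma pi_part_mul p x y : nu G p ->
  pi_part p (x ∙ y) = pi_part p x ∙ pi_part p y.
Proof.
move=> np; apply: pi_part_mul_of => K gT f coK fqf a b Ka Kb.
by have [] := fq_constt_mul coK fqf np Ka Kb.
Qed.

Lemma pi_part_compl_mul p x y : nu G p ->
  pi_part p^'%N (x ∙ y) = pi_part p^'%N x ∙ pi_part p^'%N y.
Proof.
move=> np; apply: pi_part_mul_of => K gT f coK fqf a b Ka Kb.
by have [] := fq_constt_mul coK fqf np Ka Kb.
Qed.

Lemma pi_part_nu'_mul x y :
  pi_part nup^'%N (x ∙ y) = pi_part nup^'%N x ∙ pi_part nup^'%N y.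
Proof.
apply: pi_part_mul_of => K gT f coK fqf a b; exact: fq_constt_nu'_mul.
Qed.

(** * Closedness and normality *)

Lemma morph_one (h : T -> T) : {morph h : x y / x ∙ y} -> h one = one.
Proof.
move=> hM; have : h one ∙ h one = h one by rewrite -hM tmul1.
by move=> /(congr1 (tmul G (inv (h one)))); rewrite tmulK tmulV.
Qed.

Lemma morph_inv (h : T -> T) x :
  {morph h : x y / x ∙ y} -> h (inv x) = inv (h x).
Proof.
by move=> hM; apply/esym/tinv_uniq; rewrite -hM tmulxV morph_one.
Qed.

Lemma kernel_normal (I : Type) (P : I -> Prop) (h : I -> T -> T) :
  (forall i, P i -> {morph h i : x y / x ∙ y}) ->
  is_normal_subgroup G [set x | forall i, P i -> h i x = one].
Proof.
move=> hM; split; [split|] => /=.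
- by move=> i Pi; exact: morph_one (hM i Pi).
- by move=> x y xP yP i Pi; rewrite hM // xP // yP // tmul1.
- by move=> x xP i Pi; rewrite (morph_inv x (hM i Pi)) xP // tinv1.
move=> g x xP i Pi; have hMi := hM i Pi.
by rewrite !hMi xP // tmulx1 (morph_inv g hMi) tmulxV.
Qed.

Lemma G_nu'E : G_sigma G (nu' G) =
  [set x | forall p : nat, nu G p -> pi_part p x = one].
Proof. by apply/seteqP; split=> x /G_nu'P. Qed.

(** The one-point index set gives this kernel the shape expected by [kernel_normal]. *)
Lemma G_pE p : prime p -> G_p G p =
  [set x | forall q : nat, q = p -> pi_part q^'%N x = one].
Proof.
move=> pr_p; apply/seteqP; split=> x; first by move=> /G_pP px _ ->; exact: px.
by move=> px; apply/G_pP => //; exact: px.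
Qed.

Lemma pi_part_kernel_closed pi : closed [set x | pi_part pi x = one].
Proof.
apply: (@closed_comp _ _ (pi_part pi) [set one]); last exact: closed_tone.
by move=> x _; exact: pi_part_cont.
Qed.

Lemma G_nu'_closed : closed (G_sigma G (nu' G)).
Proof.
rewrite G_nu'E.
have -> : [set x | forall p : nat, nu G p -> pi_part p x = one] =
    \bigcap_(p in nu G) [set x | pi_part p x = one] by [].
by apply: closed_bigI => p _; exact: pi_part_kernel_closed.
Qed.

Lemma G_nu'_normal : is_normal_subgroup G (G_sigma G (nu' G)).
Proof.
by rewrite G_nu'E; apply: kernel_normal => p np x y; exact: pi_part_mul.
Qed.

Lemma G_p_closed p : prime p -> closed (G_p G p).
Proof.
move=> pr_p; have -> : G_p G p = [set x | pi_part p^'%N x = one].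
  by apply/seteqP; split=> x /G_pP; apply.
exact: pi_part_kernel_closed.
Qed.

Lemma G_p_normal p : nu G p -> is_normal_subgroup G (G_p G p).
Proof.
move=> np; have [pr_p _] := np; rewrite G_pE //; apply: kernel_normal => q -> x y.
exact: pi_part_compl_mul.
Qed.

(** * The decomposition as a local product *)

Definition local_coord x : T * (nat -> T) :=
  (pi_part nup^'%N x, fun p => if `[< nu G p >] then pi_part p x else one).

Lemma local_coord_mul x y :
  local_coord (x ∙ y) = locprod_mul G (local_coord x) (local_coord y).
Proof.
rewrite /local_coord /locprod_mul /= pi_part_nu'_mul; congr pair.
apply: funext => p; case: asboolP => np; first exact: pi_part_mul.
by rewrite tmul1.
Qed.

(** Having all coordinates in one compact [K] provides the cluster point. That [x] stays in [K] is
    needed for openness of the image. *)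
Lemma local_coord_surj K z : co_subgroup K -> K z.1 -> G_sigma G (nu' G) z.1 ->
  (forall p, K (z.2 p)) -> (forall p, nu G p -> G_p G p (z.2 p)) ->
  (forall p, ~ nu G p -> z.2 p = one) -> exists2 x, K x & local_coord x = z.
Proof.
case: z => z1 z2 /= coK Kz1 z1nu' Kz2 z2p z2one.
have [sK cK _] := coK; have [K1 KM _] := sK.
pose t := fix t n := if n is m.+1 then t m ∙ z2 m else z1.
have Kt n : K (t n) by elim: n => //= n IHn; exact: KM.
have PF : ProperFilter (t @ \oo) by exact: fmap_proper_filter.
have [|x [Kx clx]] := cK _ PF; first by exists 0%N => // n _; exact: Kt.
have ft (gT : finGroupType) (f : T -> gT) N : finite_quotient K f ->
    exists2 n, N <= n & f x = f (t n).
  move=> [_ /(_ _ Kx) nx].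
  have [|_ [[n Nn <-] [_ fn]]] := clx (t @` [set n | N <= n]) _ _ nx.
    by exists N => // n Nn; exists n.
  by exists n.
have z2_elt (gT : finGroupType) (f : T -> gT) p : finite_quotient K f ->
    nu G p -> p.-elt%g (f (z2 p)).
  by move=> fqf np; apply: (G_p_pelt (z2p p np) coK fqf).
exists x => //; rewrite /local_coord; congr pair.
  apply: (pi_part_uniq coK) => // gT f fqf.
  have [n _ ->] := ft _ f 0 fqf; elim: n => [|n IHn] /=.
    by rewrite constt_p_elt //; exact: G_nu'_elt coK fqf Kz1.
  rewrite (fq_constt_nu'_mul coK fqf) // -IHn.
  suff -> : ((f (z2 n)).`_nup^' = 1)%g by rewrite mulg1.
  have [nn|/z2one->] := pselect (nu G n); last by rewrite (fq_one sK fqf) constt1.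
  apply/constt1P; rewrite p_eltNK; apply: sub_p_elt (z2_elt _ _ _ fqf nn) => q.
  by rewrite inE => /eqP ->; apply/asboolP.
apply: funext => p; case: asboolP => np; last by rewrite z2one.
apply: (pi_part_uniq coK) => // gT f fqf.
(* From index [p.+1] on, the partial product contains the factor [z2 p], the only one with a
   nontrivial p-part under [f]. *)
have [n lt_pn ->] := ft _ f p.+1 fqf.
suff -> : ((f (t n)).`_p = if p < n then f (z2 p) else 1)%g by rewrite lt_pn.
elim: n {lt_pn} => [|n IHn] /=.
  apply/constt1P; apply: sub_p_elt (G_nu'_elt z1nu' coK fqf Kz1) => q.
  by rewrite !inE; apply: contraNN => /eqP ->; apply/asboolP.
have [-> _] := fq_constt_mul coK fqf np (Kt n) (Kz2 n).
rewrite IHn ltnS [p <= n]leq_eqVlt; case: eqVneq => [eq_pn|neq] /=.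
  by rewrite -eq_pn ltnn mul1g constt_p_elt //; exact: z2_elt.
suff -> : ((f (z2 n)).`_p = 1)%g by rewrite mulg1.
have [nn|/z2one->] := pselect (nu G n); last by rewrite (fq_one sK fqf) constt1.
apply/constt1P; apply: sub_p_elt (z2_elt _ _ _ fqf nn) => q.
by rewrite !inE => /eqP ->; rewrite eq_sym.
Qed.

Lemma local_coord_kernel u : (forall p, nu G p -> pi_part p u = one) ->
  pi_part nup^'%N u = one -> u = one.
Proof.
move=> u_p u_nu; have [K coK Ku] := co_subgroup_exists u.
have [sK _ _] := coK; have [K1 _ _] := sK.
apply: (fq_eq coK) => // gT f fqf; have f1 := fq_one sK fqf; rewrite f1.
apply: (fq_eq1 (K := K)) => [|p np|].
- by [].
- by rewrite -(pi_part_fq _ coK fqf Ku) u_p.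
- by rewrite -(pi_part_fq _ coK fqf Ku) u_nu.
Qed.

Lemma local_coord_inj x y : local_coord x = local_coord y -> x = y.
Proof.
move=> [xy1 xy2]; apply: tdiv_eq1; apply: local_coord_kernel => [p np|].
  have := congr1 (fun g => g p) xy2; rewrite asboolT // => xy.
  rewrite pi_part_mul // (morph_inv _ (fun a b => pi_part_mul a b np)).
  by rewrite xy tmulV.
by rewrite pi_part_nu'_mul (morph_inv _ pi_part_nu'_mul) xy1 tmulV.
Qed.

Section LocalProduct.
Variable K0 : set T.
Hypothesis coK0 : co_subgroup K0.

(** Cutting all factors from a single [K0] makes the condition on infinitely many coordinates a
    consequence of membership in [K0]. *)
Definition local_factor p := K0 `&` G_p G p.

Lemma local_factorP p : nu G p ->
  [/\ is_subgroup G (local_factor p), local_factor p `<=` G_p G p,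
      compact (local_factor p) & open_in (G_p G p) (local_factor p)].
Proof.
move=> np; have [pr_p _] := np; have [[K1 KM KV] cK oK] := coK0.
have [[G1 GM GV] _] := G_p_normal np; split.
- split; first by [].
    by move=> x y [Kx Gx] [Ky Gy]; split; [exact: KM|exact: GM].
  by move=> x [Kx Gx]; split; [exact: KV|exact: GV].
- by move=> x [].
- exact: compact_closedI cK (G_p_closed pr_p).
- by exists K0.
Qed.

Lemma local_coord_carrier x : locprod_carrier G local_factor (local_coord x).
Proof.
split=> /= [|p np|p np|].
- exact: pi_part_G_nu'.
- by rewrite asboolT //; apply: pi_part_G_p; case: np.
- by rewrite asboolF.
have [K coK Kx] := co_subgroup_exists x; have [[K01 _ _] _ oK0] := coK0.
(* The kernel of [f] lies in [K0], so a p-part of [x] outside [K0] forces [p] to be at most the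
   order of ['S_m]. *)
have [m [f [fqf kerf]]] := co_subgroup_basis coK (open_nbhs_nbhs (conj oK0 K01)).
apply: sub_finite_set (finite_II #|'S_m|.+1) => p /= [np nUp].
have [pr_p _] := np; rewrite asboolT // in nUp.
rewrite ltnS leqNgt; apply/negP => lt_p; apply: nUp; split.
  by apply: kerf; [exact: pi_part_sub|exact: (fq_large_part coK fqf)].
exact: pi_part_G_p.
Qed.

Lemma local_coord_open_preimage W :
  locprod_open G local_factor W -> open (local_coord @^-1` W).
Proof.
move=> [_ oW]; rewrite openE => x /= /oW[Q [S [V [oQ Qx fS SV sW]]]].
have [n Sn] := finite_nat_bounded fS; have [[K01 _ _] _ oK0] := coK0.
have near1 : \forall y \near x, Q (local_coord y).1.
  by apply: (@pi_part_cont nup^'%N x); exact: open_nbhs_nbhs.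
have near2 : \forall y \near x,
    forall i : 'I_n, S i -> V i ((local_coord y).2 i).
  apply: filter_forall => i.
  have [Si|nSi] := pselect (S i); last by apply: nearW => y /nSi.
  have [oV] := SV _ Si; rewrite /=; case: asboolP => np Vx; last exact: nearW.
  have ev : \forall y \near x, V i (pi_part i y) :=
    @pi_part_cont i x (V i) (open_nbhs_nbhs (conj oV Vx)).
  by apply: filterS ev => y Vy _.
(* Once [inv x ∙ y] is in [K0], so are all its parts; this handles every [p] at once. *)
have near3 := nbhs_ldiv x (open_nbhs_nbhs (conj oK0 K01)).
apply: filterS3 near1 near2 near3 => y Qy Vy Ky.
apply: sW; [exact: local_coord_carrier|by []| |].
  by move=> p Sp; exact: (Vy (Ordinal (Sn _ Sp)) Sp).
move=> p np; have [pr_p _] := np.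
rewrite /= asboolT // -(morph_inv _ (fun a b => pi_part_mul a b np)).
by rewrite -pi_part_mul //; split; [exact: pi_part_sub|exact: pi_part_G_p].
Qed.

Lemma local_coord_open_image O :
  open O -> locprod_open G local_factor (local_coord @` O).
Proof.
move=> oO; split=> [_ [x _ <-]|_ [x Ox <-]]; first exact: local_coord_carrier.
have [sK0 _ _] := coK0; have [K01 _ _] := sK0.
have [m [f [fqf kerf]]] :=
  co_subgroup_basis coK0 (nbhs_lmul (open_nbhs_nbhs (conj oO Ox))).
have [_ /(_ _ K01)] := fqf; rewrite (fq_one sK0 fqf) => ker_nbhs.
(* [D a] is the coset of [a] modulo the kernel of [f]. It constrains only the nu'-part and the
   primes up to the order of ['S_m], since [f] kills the parts of elements of [K0] at larger
   primes. *)
pose D a := [set b | K0 (inv a ∙ b) /\ f (inv a ∙ b) = 1%g].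
have Da a : (D a)° a := nbhs_ldiv a ker_nbhs.
set z := local_coord x.
exists (D z.1)°, `I_(#|'S_m|.+1), (fun p => (D (z.2 p))°); split.
- exact: open_interior.
- exact: Da.
- exact: finite_II.
- by move=> p _; split; [exact: open_interior|exact: Da].
move=> w [w1 w2 w3 _] /interior_subset[Kw1 fw1] wS wU.
have [z1 z2 z3 _] : locprod_carrier G local_factor z := local_coord_carrier x.
pose v := (inv z.1 ∙ w.1, fun p => inv (z.2 p) ∙ w.2 p).
have v3 p : ~ nu G p -> v.2 p = one.
  by move=> np; rewrite -[v.2 p]/(inv (z.2 p) ∙ w.2 p) z3 // w3 // tmulV.
have [|p|p np||u Ku uv] := local_coord_surj (z := v) coK0 Kw1.
- have [[_ HM HV] _] := G_nu'_normal; apply: HM => //; exact: HV.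
- by have [/wU[]//|/v3->] := pselect (nu G p).
- have [[_ HM HV] _] := G_p_normal np.
  by apply: HM; [apply: HV; exact: z2|exact: w2].
- exact: v3.
(* All parts of [u] die under [f], so [u] is in the kernel and [x ∙ u] is in [O]. *)
exists (x ∙ u).
  apply: kerf => //; apply: (fq_eq1 Ku) => [p np|].
    have [pr_p _] := np; rewrite -(pi_part_fq _ coK0 fqf Ku).
    have [le_p|lt_p] := leqP p #|'S_m|; last exact: (fq_large_part coK0 fqf).
    have /interior_subset[_ <-] := wS p le_p.
    by have := congr1 (fun g => g.2 p) uv; rewrite /= asboolT // => ->.
  rewrite -(pi_part_fq _ coK0 fqf Ku).
  by have := congr1 fst uv; rewrite /= => ->.
rewrite local_coord_mul uv -/z /locprod_mul /v; case: (w) => a b /=.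
by congr pair; [exact: tmulVK|apply: funext => p; exact: tmulVK].
Qed.

End LocalProduct.

Lemma locprod_isoP : exists K0, co_subgroup K0 /\
  locprod_iso G (local_factor K0) local_coord.
Proof.
have [F [Fco Fdir FT]] := crG.
(* Taking [K0] in the directed family allows a member containing [K0], [z.1] and the finitely many
   coordinates outside [K0]. *)
have [K0 FK0 _] : (\bigcup_(U in F) U) one by rewrite FT.
have coK0 : co_subgroup K0 := Fco _ FK0.
exists K0; split=> //; split; last first.
  split=> [W|O]; first exact: local_coord_open_preimage.
  exact: local_coord_open_image.
split=> [x|x y|z [z1 z2 z3 fz]|x y].
- exact: local_coord_carrier.
- exact: local_coord_inj.
- have [n zn] := finite_nat_bounded fz.
  have cover k : exists K, [/\ F K, K0 `<=` K, K z.1 &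
      forall p, p < k -> K (z.2 p)].
    have dirF K x : F K -> exists L, [/\ F L, K `<=` L & L x].
      move=> FK; have [L FL Lx] : (\bigcup_(U in F) U) x by rewrite FT.
      by have [M [FM KM LM]] := Fdir _ _ FK FL; exists M; split=> //; exact: LM.
    elim: k => [|k [K [FK K0K Kz Kk]]].
      by have [L [FL K0L Lz]] := dirF _ z.1 FK0; exists L.
    have [L [FL KL Lz]] := dirF _ (z.2 k) FK.
    exists L; split=> //; [by move=> x /K0K/KL|exact: KL|move=> p].
    by rewrite ltnS leq_eqVlt => /predU1P[->//|/Kk/KL].
  have [K [FK K0K Kz Kn]] := cover n.
  have [|x _ <-] := local_coord_surj (Fco _ FK) Kz z1 _ z2 z3; last by exists x.
  move=> p; have [/Kn//|le_np] := ltnP p n.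
  have [np|/z3->] := pselect (nu G p); last by have [[]] := Fco _ FK.
  apply: contrapT => nKp; suff /zn : nu G p /\ ~ local_factor K0 p (z.2 p).
    by rewrite ltnNge le_np.
  by split=> // -[/K0K].
- exact: local_coord_mul.
Qed.

End TopologicalGroups.

Theorem theorem5p8 (T : topologicalType) (G : tgroup T) :
  is_topgroup G -> periodic_group G -> compactly_ruled G ->
  [/\ closed (G_sigma G (nu' G)) /\ is_normal_subgroup G (G_sigma G (nu' G)),
      (forall p, nu G p ->
         is_normal_subgroup G (G_p G p) /\ is_sylow G [set p] (G_p G p)) &
      exists U : nat -> set T,
        (forall p, nu G p ->
           [/\ is_subgroup G (U p), U p `<=` G_p G p, compact (U p) &
               open_in (G_p G p) (U p)]) /\
        exists phi : T -> T * (nat -> T), locprod_iso G U phi].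
Proof.
move=> tG perG crG; split.
- by split; [exact: G_nu'_closed|exact: G_nu'_normal].
- move=> p np; have nGp := G_p_normal tG perG crG np; split=> //.
  (* Maximality is immediate, as [G_p] consists of all p-elements. *)
  have [sGp _] := nGp; split=> // H _ HGp GpH.
  exact/seteqP.
have [K0 [coK0 iso]] := locprod_isoP tG perG crG.
exists (local_factor G K0); split; first by move=> p; exact: local_factorP.
by exists (local_coord G).
Qed.
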